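(* Let $n\ge 2$ and $k\ge 2$ be integers. The maximum of the genus $g(Q)$ over all Jenga-like configurations $Q$ of the $(n,k)$-game equals $$ g(n,k)=\begin{cases}\dfrac{n(n-2)(k-2)}{2} & \text{if } n \text{ is even},\\[2mm] \dfrac{n(n-1)(k-2)}{2} & \text{if } n \text{ is odd}.\end{cases} $$ That is, every Jenga-like configuration $Q$ satisfies $g(Q)\le g(n,k)$, and some Jenga-like configuration (the $(n,k)$-configuration) has genus exactly $g(n,k)$.
   Context: The $(n,k)$-Jenga game ($(n,k)$-game) is played with $nk$ congruent blocks, each a box of length $n$, width $1$ and height $1$. Positions are organised in levels $1,2,3,\dots$ from the ground up; level $i$ occupies heights $[i-1,i]$ and has $n$ slots $j=1,\dots,n$. A block in slot $j$ of an odd level $i$ is the box $[0,n]\times[j-1,j]\times[i-1,i]$, and a block in slot $j$ of an even level $i$ is the box $[j-1,j]\times[0,n]\times[i-1,i]$ (consecutive levels are rotated by $90^\circ$). The initial configuration has $k$ levels, each with all $n$ slots filled. A move consists of removing exactly one block from some level, which is not the topmost level and, when the topmost level is incomplete (has fewer than $n$ blocks), is not the level immediately below the topmost level, and placing it in an empty slot of the topmost level if that level is incomplete, or in a slot of a new level on top if the topmost level is complete. A Jenga-like configuration is any configuration obtainable from the initial one by finitely many moves in which every level up to the topmost contains at least one block (physical stability is otherwise disregarded). For such a configuration $Q$, the boundary of the union of its blocks is a connected closed polyhedral surface in $\mathbb R^3$ (each edge lies in exactly two faces and the link of each vertex is connected); $g(Q)$ denotes its genus. *)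

(* Defs.v *)
From HB Require Import structures.
From mathcomp Require Import all_boot all_order all_algebra.
Set Implicit Arguments. Unset Strict Implicit. Unset Printing Implicit Defensive.
Import Order.TTheory GRing.Theory Num.Theory.

(* A configuration with h levels: a sequence of h sets of occupied slots.
   Level i (1-based) is [nth set0 Q (i-1)]; slot j (1-based) is the ordinal j-1. *)

Definition complete (n : nat) (L : {set 'I_n}) : bool := L == [set: 'I_n].

Definition levels_nonempty (n : nat) (Q : seq {set 'I_n}) : bool :=
  all (fun L => L != set0) Q.

Definition jmove (n : nat) (Q Q' : seq {set 'I_n}) : Prop :=
  let h := size Q in
  let top := last set0 Q in
  exists (i : nat) (s : 'I_n),
    [/\ i.+1 < h,
        (~~ complete top -> i.+2 < h),
        s \in nth set0 Q i
      & let Q1 := set_nth set0 Q i (nth set0 Q i :\ s) in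
        if complete top
        then exists t : 'I_n, Q' = rcons Q1 [set t]
        else exists2 t : 'I_n, t \notin top & Q' = set_nth set0 Q1 h.-1 (t |: top)].

Inductive jenga_like (n k : nat) : seq {set 'I_n} -> Prop :=
  | JL_init : @jenga_like n k (nseq k [set: 'I_n])
  | JL_move (Q Q' : seq {set 'I_n}) :
      @jenga_like n k Q -> jmove Q Q' -> levels_nonempty Q' -> @jenga_like n k Q'.
Arguments jenga_like : clear implicits.

(* Geometry: unit cube [x,x+1]x[y,y+1]x[z,z+1] (x,y,z : nat) belongs to a block. *)
Definition in_level (n : nat) (L : {set 'I_n}) (j : nat) : bool :=
  [exists s in L, nat_of_ord s == j].

Definition block_cell (n : nat) (Q : seq {set 'I_n}) (x y z : nat) : bool :=
  [&& z < size Q, x < n, y < n &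
      if odd z then in_level (nth set0 Q z) x   (* even level i = z+1: block [j-1,j]x[0,n] *)
      else in_level (nth set0 Q z) y].          (* odd level i = z+1: block [0,n]x[j-1,j] *)

(* Occupancy with coordinates shifted by one (cell (x,y,z) here is the unit
   cube with lower corner (x-1,y-1,z-1)), so that all cells adjacent to the
   solid have natural coordinates. *)
Definition occ (n : nat) (Q : seq {set 'I_n}) (x y z : nat) : bool :=
  [&& 0 < x, 0 < y, 0 < z & block_cell Q x.-1 y.-1 z.-1].

Definition mixed (s : seq bool) : bool := has id s && ~~ all id s.

Definition bnd (n : nat) (Q : seq {set 'I_n}) : nat := n + size Q + 2.

(* Cells of the boundary surface, subdivided into unit squares, unit edges and
   lattice vertices. *)
Definition nfaces (n : nat) (Q : seq {set 'I_n}) : nat :=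
  \sum_(x < bnd Q) \sum_(y < bnd Q) \sum_(z < bnd Q)
    ((occ Q x y z != occ Q x.+1 y z) + (occ Q x y z != occ Q x y.+1 z)
     + (occ Q x y z != occ Q x y z.+1))%N.

Definition nedges (n : nat) (Q : seq {set 'I_n}) : nat :=
  \sum_(x < bnd Q) \sum_(y < bnd Q) \sum_(z < bnd Q)
    (mixed [:: occ Q x y z; occ Q x.+1 y z; occ Q x y.+1 z; occ Q x.+1 y.+1 z]
     + mixed [:: occ Q x y z; occ Q x y.+1 z; occ Q x y z.+1; occ Q x y.+1 z.+1]
     + mixed [:: occ Q x y z; occ Q x.+1 y z; occ Q x y z.+1; occ Q x.+1 y z.+1])%N.

Definition nverts (n : nat) (Q : seq {set 'I_n}) : nat :=
  \sum_(x < bnd Q) \sum_(y < bnd Q) \sum_(z < bnd Q)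
    mixed [:: occ Q x y z; occ Q x.+1 y z; occ Q x y.+1 z; occ Q x.+1 y.+1 z;
              occ Q x y z.+1; occ Q x.+1 y z.+1; occ Q x y.+1 z.+1;
              occ Q x.+1 y.+1 z.+1].

Definition euler (n : nat) (Q : seq {set 'I_n}) : int :=
  ((nverts Q)%:Z - (nedges Q)%:Z + (nfaces Q)%:Z)%R.

(* genus of the closed (orientable) boundary surface: chi = 2 - 2g *)
Definition genus (n : nat) (Q : seq {set 'I_n}) : int :=
  ((2 - euler Q)%R %/ 2)%Z.

Definition gnk (n k : nat) : nat :=
  if odd n then (n * (n - 1) * (k - 2)) %/ 2 else (n * (n - 2) * (k - 2)) %/ 2.

(* Main.v *)
(** Let r_i be the number of maximal runs of adjacent blocks in level i, of h.
    Levels are unions of r_i boxes, consecutive levels meet in r_i r_(i+1)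
    rectangles, so the solid has Euler characteristic
    sum r_i - sum r_i r_(i+1), and its boundary twice that. The level below the
    topmost one is always full, because the topmost level is started only
    above a full level, and blocks are not removed from below an incomplete top.
    Hence the genus is the sum of r_i (r_(i+1) - 1) over 1 <= i <= h-3. When level
    h-1 is completed, level h-2 is also full, so at most n (k-2) blocks lie
    below; as r_i is at most the number of blocks of level i, and at most
    (n+1)/2, the genus is at most n (k-2) (floor((n+1)/2) - 1) = g(n,k).
    Conversely, every choice of nonempty levels with n (k-2) blocks in total can
    be reached below two full levels. Taking isolated blocks, floor((n+1)/2) on
    each level but the lowest, and then thinning out the first full level in the
    same way gives equality. *)
Require Import Defs.
From HB Require Import structures.
From mathcomp Require Import all_boot all_order all_algebra.
From mathcomp Require Import zify ring.
Set Implicit Arguments. Unset Strict Implicit. Unset Printing Implicit Defensive.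
Import Order.TTheory GRing.Theory Num.Theory.

(** * Slots and runs of a single level *)

Definition slot n (L : {set 'I_n}) (x : nat) : bool := (0 < x) && in_level L x.-1.

(** The extent of a block along its length. As in [slot], coordinates are shifted like those of
    [occ], so position 0 is always empty. *)
Definition box n (x : nat) : bool := 0 < x <= n.

Definition run_start (u : nat -> bool) (x : nat) : bool := ~~ u x && u x.+1.

Definition run_end (u : nat -> bool) (x : nat) : bool := u x && ~~ u x.+1.

(** Each run is counted at its last slot; [in_level L n] is false, so a run reaching the border
    counts too. *)
Definition runs n (L : {set 'I_n}) : nat :=
  \sum_(j < n) (in_level L j && ~~ in_level L j.+1).

Lemma in_level_ord n (L : {set 'I_n}) (j : 'I_n) : in_level L j = (j \in L).
Proof.
apply/existsP/idP => [[s /andP[sL /eqP/val_inj <-]] //|jL].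
by exists j; rewrite jL eqxx.
Qed.

Lemma in_level_ge n (L : {set 'I_n}) j : n <= j -> in_level L j = false.
Proof.
move=> lenj; apply/negbTE/existsP => -[s /andP[_ /eqP sj]].
by have := ltn_ord s; rewrite sj ltnNge lenj.
Qed.

Lemma in_level0 n j : in_level (set0 : {set 'I_n}) j = false.
Proof. by apply/negbTE/existsP => -[s]; rewrite inE. Qed.

Lemma in_levelT n j : in_level [set: 'I_n] j = (j < n).
Proof.
case: ltnP => [ltjn|]; last exact: in_level_ge.
by rewrite (in_level_ord setT (Ordinal ltjn)) inE.
Qed.

Lemma sum_in_level n (L : {set 'I_n}) : \sum_(j < n) in_level L j = #|L|.
Proof.
rewrite -sum1_card [RHS]big_mkcond /=.
by apply: eq_bigr => j _; rewrite in_level_ord; case: (_ \in _).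
Qed.

Lemma slot_box n (L : {set 'I_n}) x : slot L x -> box n x.
Proof.
case: x => // x; rewrite /slot /box /=; case: ltnP => // lenx.
by rewrite in_level_ge.
Qed.

Lemma sum_run_end n (L : {set 'I_n}) B : n < B ->
  \sum_(x < B) run_end (slot L) x = runs L.
Proof.
case: B => // B; rewrite ltnS => lenB.
rewrite big_ord_recl /= add0n -(subnKC lenB) big_split_ord /=.
rewrite [X in _ + X]big1 ?addn0 // => i _.
by rewrite /run_end /slot /bump /= in_level_ge ?leq_addr .
Qed.

(** Starts minus ends telescope to [u B - u 0]. *)
Lemma sum_run_start (u : nat -> bool) B : u 0 = u B ->
  \sum_(x < B) run_start u x = \sum_(x < B) run_end u x.
Proof.
move=> u0B.
suff: u 0 + \sum_(x < B) run_start u x = u B + \sum_(x < B) run_end u x.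
  by rewrite u0B => /addnI.
elim: B {u0B} => [|B IH]; first by rewrite !big_ord0.
rewrite !big_ord_recr /=; move: IH.
move: (\sum_(_ < B) _) (\sum_(_ < B) _) => S E; rewrite /run_start /run_end.
by case: (u 0); case: (u B); case: (u B.+1); rewrite /=; lia.
Qed.

Lemma runs0 n : runs (set0 : {set 'I_n}) = 0.
Proof. by rewrite /runs big1 // => j _; rewrite in_level0. Qed.

Lemma runsT n : 0 < n -> runs [set: 'I_n] = 1.
Proof.
case: n => // n _; rewrite /runs big_ord_recr /= !in_levelT ltnSn ltnn /= big1 //.
by case=> j /= ltjn _; rewrite !in_levelT ltnS [in X in ~~ X]ltnS ltjn andbF.
Qed.

Lemma runs_le_card n (L : {set 'I_n}) : runs L <= #|L|.
Proof.
by rewrite -sum_in_level; apply: leq_sum => j _; case: in_level; case: in_level.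
Qed.

(* Each run uses up its last slot and the free position after it, out of n + 1. *)
Lemma runs_le_half n (L : {set 'I_n}) : runs L <= n.+1./2.
Proof.
suff: runs L + runs L <= n.+1 by lia.
pose S m := \sum_(j < m) (in_level L j && ~~ in_level L j.+1).
suff H m : S m + S m + in_level L m <= m + in_level L 0.
  by have := H n; rewrite /runs -/(S n); case: (in_level L 0); lia.
elim: m => [|m]; first by rewrite /S big_ord0.
rewrite /S big_ord_recr /= -/(S m).
by case: (in_level L m); case: (in_level L m.+1); case: (in_level L 0); rewrite /=; lia.
Qed.

(** * The Euler characteristic of the boundary in terms of runs *)

Section Euler.
Context (n : nat) (Q : seq {set 'I_n}).

(** Level [z] counted from 1; the empty sets at 0 and beyond the top stand for the space under and
    over the tower. *)
Let lev z : {set 'I_n} := if z is z'.+1 then nth set0 Q z' else set0.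

Lemma occ_odd x y z : odd z -> occ Q x y z = box n x && slot (lev z) y.
Proof.
case: z => // z /= /negbTE ev; rewrite /occ /block_cell /slot /box /= ev.
case: x => [|x] /=; case: y => [|y] /=; rewrite ?andbF //.
case: ltnP => [_|leQ] /=; last by rewrite nth_default // in_level0 ?andbF.
by case: (ltnP y n) => //= leny; rewrite in_level_ge // andbF.
Qed.

Lemma occ_even x y z : ~~ odd z -> occ Q x y z = slot (lev z) x && box n y.
Proof.
case: z => [_|z /=]; first by rewrite /occ /slot in_level0 !andbF.
rewrite negbK => od; rewrite /occ /block_cell /slot /box /= od.
case: x => [|x] /=; case: y => [|y] /=; rewrite ?andbF //.
case: ltnP => [_|leQ] /=; last by rewrite nth_default // in_level0.
case: (ltnP x n) => //= lenx; first by rewrite andbC.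
by rewrite in_level_ge.
Qed.

(** The share of one lattice point in V - E + F: the point itself with the three edges and three
    squares of which it is the largest corner. *)
Let local x y z : int :=
  ((mixed [:: occ Q x y z; occ Q x.+1 y z; occ Q x y.+1 z; occ Q x.+1 y.+1 z;
              occ Q x y z.+1; occ Q x.+1 y z.+1; occ Q x y.+1 z.+1;
              occ Q x.+1 y.+1 z.+1])%:Z
  - (mixed [:: occ Q x y z; occ Q x.+1 y z; occ Q x y.+1 z; occ Q x.+1 y.+1 z]
     + mixed [:: occ Q x y z; occ Q x y.+1 z; occ Q x y z.+1; occ Q x y.+1 z.+1]
     + mixed [:: occ Q x y z; occ Q x.+1 y z; occ Q x y z.+1; occ Q x.+1 y z.+1])%N%:Z
  + ((occ Q x y z != occ Q x.+1 y z) + (occ Q x y z != occ Q x y.+1 z)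
     + (occ Q x y z != occ Q x y z.+1))%N%:Z)%R.

Lemma euler_local :
  euler Q = (\sum_(z < bnd Q) \sum_(x < bnd Q) \sum_(y < bnd Q) local x y z)%R.
Proof.
have sumZ (F : 'I_(bnd Q) -> 'I_(bnd Q) -> 'I_(bnd Q) -> nat) :
    (\sum_(x < bnd Q) \sum_(y < bnd Q) \sum_(z < bnd Q) F x y z)%N%:Z%R =
    (\sum_(x < bnd Q) \sum_(y < bnd Q) \sum_(z < bnd Q) (F x y z)%:Z)%R.
  rewrite (big_morph Posz PoszD (erefl _)); apply: eq_bigr => x _.
  rewrite (big_morph Posz PoszD (erefl _)); apply: eq_bigr => y _.
  exact: (big_morph Posz PoszD (erefl _)).
rewrite exchange_big /=.
under [RHS]eq_bigr => x _ do rewrite exchange_big /=.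
rewrite /euler /nverts /nedges /nfaces !sumZ -sumrB -big_split /=.
apply: eq_bigr => x _; rewrite -sumrB -big_split /=.
by apply: eq_bigr => y _; rewrite -sumrB -big_split.
Qed.

(* The blocks of one of the two levels at height z are indexed by x, those of
   the other by y, so the contributions factor; for each z they sum to
   r + r' - 2 r r', with r and r' the numbers of runs of the two levels. *)
Lemma local_even x y z : ~~ odd z ->
  local x y z =
  ((run_start (box n) x)%:Z * (run_start (slot (lev z.+1)) y)%:Z
   - (run_start (slot (lev z)) x)%:Z * (run_start (slot (lev z.+1)) y)%:Z
   - (run_end (slot (lev z)) x)%:Z * (run_end (slot (lev z.+1)) y)%:Z
   + (run_end (slot (lev z)) x)%:Z * (run_end (box n) y)%:Z)%R.
Proof.
move=> ev; rewrite /local !(occ_even _ _ ev).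
have od : odd z.+1 by [].
rewrite !(occ_odd _ _ od) /run_start /run_end.
(* Occupied slots lie in [box]; given this, the identity is a truth table in eight booleans. *)
have := @slot_box n (lev z) x; have := @slot_box n (lev z) x.+1.
have := @slot_box n (lev z.+1) y; have := @slot_box n (lev z.+1) y.+1.
move: (slot (lev z) x) (slot (lev z) x.+1) (slot (lev z.+1) y) (slot (lev z.+1) y.+1).
move: (box n x) (box n x.+1) (box n y) (box n y.+1).
by do 8![case]; move=> // h1 h2 h3 h4;
   (try by move: (h1 isT)); (try by move: (h2 isT)); (try by move: (h3 isT)); (try by move: (h4 isT)).
Qed.

Lemma local_odd x y z : odd z ->
  local x y z =
  ((run_start (slot (lev z.+1)) x)%:Z * (run_start (box n) y)%:Z
   - (run_start (slot (lev z.+1)) x)%:Z * (run_start (slot (lev z)) y)%:Z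
   - (run_end (slot (lev z.+1)) x)%:Z * (run_end (slot (lev z)) y)%:Z
   + (run_end (box n) x)%:Z * (run_end (slot (lev z)) y)%:Z)%R.
Proof.
move=> od; rewrite /local !(occ_odd _ _ od).
have ev : ~~ odd z.+1 by rewrite negbK.
rewrite !(occ_even _ _ ev) /run_start /run_end.
have := @slot_box n (lev z) y; have := @slot_box n (lev z) y.+1.
have := @slot_box n (lev z.+1) x; have := @slot_box n (lev z.+1) x.+1.
move: (slot (lev z) y) (slot (lev z) y.+1) (slot (lev z.+1) x) (slot (lev z.+1) x.+1).
move: (box n x) (box n x.+1) (box n y) (box n y.+1).
by do 8![case]; move=> // h1 h2 h3 h4;
   (try by move: (h1 isT)); (try by move: (h2 isT)); (try by move: (h3 isT)); (try by move: (h4 isT)).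
Qed.

Let sum_prod (f g : nat -> bool) B :
  (\sum_(x < B) \sum_(y < B) (f x)%:Z * (g y)%:Z)%R
  = ((\sum_(x < B) f x)%N%:Z * (\sum_(y < B) g y)%N%:Z)%R.
Proof.
by rewrite !(big_morph Posz PoszD (erefl (Posz 0))) big_distrlr.
Qed.

Let lt_n_bnd : n < bnd Q. Proof. by rewrite /bnd; lia. Qed.

Let sum_start_slot (L : {set 'I_n}) :
  \sum_(x < bnd Q) run_start (slot L) x = runs L.
Proof.
rewrite sum_run_start ?sum_run_end // /slot (@in_level_ge _ _ (bnd Q).-1) ?andbF //.
by rewrite /bnd; lia.
Qed.

Let sum_end_box : 0 < n -> \sum_(x < bnd Q) run_end (box n) x = 1.
Proof.
move=> n_gt0; rewrite -(runsT n_gt0) -(sum_run_end setT lt_n_bnd).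
apply: eq_bigr => x _; rewrite /run_end /box /slot !in_levelT /=.
by case: (val x) => // m.
Qed.

Let sum_start_box : 0 < n -> \sum_(x < bnd Q) run_start (box n) x = 1.
Proof.
move=> n_gt0; rewrite sum_run_start ?sum_end_box // /box /=.
by rewrite [bnd Q <= n]leqNgt lt_n_bnd andbF.
Qed.

Lemma local_sum z : 0 < n ->
  (\sum_(x < bnd Q) \sum_(y < bnd Q) local x y z)%R
  = ((runs (lev z))%:Z + (runs (lev z.+1))%:Z
     - (runs (lev z))%:Z * (runs (lev z.+1))%:Z *+ 2)%R.
Proof.
move=> n_gt0; have [od|ev] := boolP (odd z).
  under eq_bigr => x _.
    under eq_bigr => y _ do rewrite local_odd //.
    rewrite big_split !sumrB /=; over.
  rewrite big_split !sumrB /= !sum_prod.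
  by rewrite !sum_start_slot !sum_run_end // sum_start_box // sum_end_box //; ring.
under eq_bigr => x _.
  under eq_bigr => y _ do rewrite local_even //.
  rewrite big_split !sumrB /=; over.
rewrite big_split !sumrB /= !sum_prod.
by rewrite !sum_start_slot !sum_run_end // sum_start_box // sum_end_box //; ring.
Qed.

(** With level [m] full and [r] runs on top, the last two levels add [1 + r - r = 1] to half the
    Euler characteristic, whatever the top is. This cancels the 1 in [g = 1 - chi / 2]. *)
Lemma genus_runs m : 0 < n -> size Q = m.+2 -> nth set0 Q m = setT ->
  genus Q = (\sum_(i < m)
    (runs (nth set0 Q i))%:Z * ((runs (nth set0 Q i.+1))%:Z - 1))%R.
Proof.
move=> n_gt0 szQ Qm.
pose r i := (runs (nth set0 Q i))%:Z%R.
have r_ge i : size Q <= i -> r i = 0%R.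
  by move=> leQi; rewrite /r nth_default // runs0.
have sum_r (f : nat -> int) j : (forall i, size Q <= i -> f i = 0%R) ->
    (\sum_(i < size Q + j) f i = \sum_(i < size Q) f i)%R.
  move=> f0; rewrite big_split_ord /= [X in (_ + X)%R]big1 ?addr0 // => i _.
  by rewrite f0 // leq_addr.
have eulerE : euler Q =
    ((\sum_(i < size Q) r i - \sum_(i < size Q) r i * r i.+1) *+ 2)%R.
  rewrite euler_local; under eq_bigr => z _ do rewrite local_sum //.
  (* The range of heights exceeds the tower: height 0 has no level below it, and from [size Q] on
     all run numbers vanish. *)
  have -> : bnd Q = (size Q + n.+1).+1 by rewrite /bnd; lia.
  rewrite sumrB big_split /= sumrMnl [X in (X + _ - _)%R]big_ord_recl.
  rewrite [X in (_ - X *+ 2)%R]big_ord_recl /= runs0 mul0r !add0r.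
  transitivity (\sum_(i < size Q + n.+1) r i + \sum_(i < size Q + n.+2) r i
    - (\sum_(i < size Q + n.+1) r i * r i.+1) *+ 2)%R; first by rewrite !addnS.
  rewrite (sum_r r) // (sum_r r) // (sum_r (fun i => r i * r i.+1)%R); first by ring.
  by move=> i leQi; rewrite r_ge // mul0r.
rewrite /genus eulerE.
have double (x : int) : (2 - x *+ 2 = (1 - x) * 2)%R by ring.
rewrite double mulzK // szQ !big_ord_recr /= -/(r m) -/(r m.+1).
rewrite (r_ge m.+2) ?szQ // {1 2 3}/r Qm runsT //.
under [RHS]eq_bigr => i _ do rewrite mulrBr mulr1.
by rewrite sumrB /r Qm runsT //; ring.
Qed.

End Euler.

(** * Which configurations can be reached *)

Section Reachability.
Context (n : nat).
Implicit Types (R S Q : seq {set 'I_n}).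

Definition blocks Q := \sum_(L <- Q) #|L|.

(** Relates the lower levels after a round of moves ([R]) to those before it ([S]); the missing
    blocks have gone to the top. *)
Definition sublevels R S : Prop :=
  size R = size S /\ forall i, nth set0 R i \subset nth set0 S i.

Local Notation F := [set: 'I_n].

Lemma blocks_cat R S : blocks (R ++ S) = blocks R + blocks S.
Proof. exact: big_cat. Qed.

Lemma blocks_nseq j (L : {set 'I_n}) : blocks (nseq j L) = j * #|L|.
Proof. by rewrite /blocks big_nseq iter_addn_0 mulnC. Qed.

Lemma blocks_nth Q : blocks Q = \sum_(i < size Q) #|nth set0 Q i|.
Proof. by rewrite /blocks (big_nth set0) big_mkord. Qed.

Lemma blocks_set_nth Q i L : i < size Q ->
  blocks (set_nth set0 Q i L) + #|nth set0 Q i| = blocks Q + #|L|.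
Proof.
elim: Q i => [//|M Q IH] [|i] /=; first by rewrite /blocks !big_cons /=; lia.
by rewrite ltnS => /IH; rewrite /blocks !big_cons -!addnA => ->.
Qed.

Lemma blocks_add_slot Q i s : i < size Q -> s \notin nth set0 Q i ->
  blocks (set_nth set0 Q i (s |: nth set0 Q i)) = (blocks Q).+1.
Proof.
move=> ltiQ sQ; have := blocks_set_nth (s |: nth set0 Q i) ltiQ.
by rewrite cardsU1 sQ; lia.
Qed.

Lemma blocks_del_slot Q i s : s \in nth set0 Q i ->
  (blocks (set_nth set0 Q i (nth set0 Q i :\ s))).+1 = blocks Q.
Proof.
move=> sQ; have ltiQ : i < size Q.
  by rewrite ltnNge; apply/negP => leQi; rewrite nth_default ?inE in sQ.
have := blocks_set_nth (nth set0 Q i :\ s) ltiQ.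
by rewrite (cardsD1 s (nth set0 Q i)) sQ; lia.
Qed.

Lemma sublevels_blocks_lt R S : sublevels R S -> R <> S ->
  exists i s, [/\ i < size R, s \in nth set0 S i & s \notin nth set0 R i].
Proof.
move=> [szRS subRS] neRS.
have [/forallP eqRS|] := boolP [forall i : 'I_(size R), nth set0 S i \subset nth set0 R i].
  case: neRS; apply: (@eq_from_nth _ set0) => // i ltiR.
  by apply/eqP; rewrite eqEsubset subRS (eqRS (Ordinal ltiR)).
rewrite negb_forall => /existsP[i /subsetPn[s sS sR]].
by exists i, s; split.
Qed.

Lemma sublevels_add R S i s : sublevels R S -> i < size R ->
  s \in nth set0 S i -> sublevels (set_nth set0 R i (s |: nth set0 R i)) S.
Proof.
move=> [szRS subRS] ltiR sS; split=> [|j].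
  by rewrite size_set_nth (maxn_idPr ltiR).
rewrite nth_set_nth /=; case: eqP => [->|//].
by rewrite subUset sub1set sS subRS.
Qed.

Lemma sublevels_leq_blocks R S : sublevels R S -> blocks R <= blocks S.
Proof.
case=> szRS subRS; rewrite !blocks_nth -szRS.
by apply: leq_sum => i _; apply: subset_leq_card.
Qed.

Lemma sublevels_blocks_eq R S : sublevels R S -> blocks S <= blocks R -> R = S.
Proof.
move=> subRS leSR; apply/eqP/negPn/negP => /eqP neRS.
have [i [s [ltiR sS sR]]] := sublevels_blocks_lt subRS neRS.
have := sublevels_leq_blocks (sublevels_add subRS ltiR sS).
by rewrite blocks_add_slot // => /leq_trans/(_ leSR); rewrite ltnn.
Qed.

Lemma sublevels_full R : sublevels R (nseq (size R) F).
Proof.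
split=> [|i]; first by rewrite size_nseq.
rewrite nth_nseq; case: ltnP => [_|leRi]; first exact: subsetT.
by rewrite nth_default // sub0set.
Qed.

Lemma levels_nonemptyS R S : sublevels R S -> levels_nonempty R ->
  levels_nonempty S.
Proof.
move=> [szRS subRS] /(all_nthP set0) R0; apply/(all_nthP set0) => i.
rewrite -szRS => /R0; apply: contraNN => /eqP S0.
by have := subRS i; rewrite S0 subset0.
Qed.

(** Serves to play backwards: blocks are put back one by one into slots still free in comparison
    with the full tower. *)
Lemma fill_levels R m : blocks R + m <= size R * n ->
  exists2 S, sublevels R S & blocks S = blocks R + m.
Proof.
elim: m => [|m IH] leRm; first by exists R; rewrite ?addn0.
have [|S subRS blS] := IH; first by lia.
have [||i [s [ltiS _ sS]]] := @sublevels_blocks_lt S (nseq (size S) F).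
- exact: sublevels_full.
- move=> eqS; have := congr1 blocks eqS; rewrite blocks_nseq cardsT card_ord.
  by rewrite -(proj1 subRS) blS; lia.
exists (set_nth set0 S i (s |: nth set0 S i)); last first.
  by rewrite blocks_add_slot // blS addnS.
split=> [|j]; first by rewrite size_set_nth (maxn_idPr ltiS) (proj1 subRS).
rewrite nth_set_nth /=; case: eqP => [->|_]; last exact: (proj2 subRS).
exact: subset_trans (proj2 subRS i) (subsetUr _ _).
Qed.

Lemma set_nth_cat R S i L : i < size R ->
  set_nth set0 (R ++ S) i L = set_nth set0 R i L ++ S.
Proof. by elim: R i => [//|M R IH] [|i] //=; rewrite ltnS => /IH ->. Qed.

Lemma set_nthK R i s : i < size R -> s \notin nth set0 R i ->
  set_nth set0 (set_nth set0 R i (s |: nth set0 R i)) i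
    ((s |: nth set0 R i) :\ s) = R.
Proof.
move=> ltiR sR; rewrite setU1K // set_set_nth eqxx.
apply: (@eq_from_nth _ set0) => [|j _]; first by rewrite size_set_nth (maxn_idPr ltiR).
by rewrite nth_set_nth /=; case: eqP => [->|].
Qed.

Lemma set_nth_top R (T T' : {set 'I_n}) :
  set_nth set0 (R ++ [:: F; T]) (size R).+1 T' = R ++ [:: F; T'].
Proof. by elim: R => //= M R ->. Qed.

Context (k : nat).

Lemma nonempty_round R (T : {set 'I_n}) : levels_nonempty R -> 0 < #|T| ->
  levels_nonempty (R ++ [:: F; T]).
Proof.
move=> R0 T0; rewrite /levels_nonempty all_cat; apply/andP; split=> //=.
have T1 : T != set0 by rewrite -card_gt0.
by rewrite T1 andbT /= andbT -card_gt0 (leq_trans T0) // subset_leq_card.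
Qed.

(* By induction on the number of blocks of S missing from R: the new top level
   is built one block at a time. *)
Lemma jenga_round S R r : jenga_like n k (S ++ [:: F]) -> sublevels R S ->
  levels_nonempty R -> blocks S = blocks R + r.+1 -> r < n ->
  exists2 T : {set 'I_n}, #|T| = r.+1 & jenga_like n k (R ++ [:: F; T]).
Proof.
move=> reachS; elim: r R => [|r IH] R subRS R0 blS ltrn.
all: have [|i [s [ltiR sS sR]]] := sublevels_blocks_lt subRS;
  first by move=> eqRS; rewrite eqRS in blS; lia.
(* [R'] is [R] with one missing block put back; the last move of the round carries that block to the
   top. *)
all: pose R' := set_nth set0 R i (s |: nth set0 R i).
all: have szR' : size R' = size R by rewrite size_set_nth (maxn_idPr ltiR).
all: have R'i : nth set0 R' i = s |: nth set0 R i by rewrite nth_set_nth /= eqxx.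
all: have subR' : sublevels R' S by exact: sublevels_add.
all: have blR' : blocks R' = (blocks R).+1 by exact: blocks_add_slot.
(* Nothing else is missing, so this move is the one that opens the new level. *)
- have eqR' : R' = S by apply: sublevels_blocks_eq => //; lia.
  pose t : 'I_n := Ordinal ltrn.
  exists [set t]; first by rewrite cards1.
  apply: (JL_move reachS); last by rewrite nonempty_round ?cards1.
  rewrite -eqR'; exists i, s; rewrite size_cat szR' /= addn1.
  rewrite last_cat /= nth_cat szR' ltiR R'i setU11.
  rewrite /complete eqxx; split=> //.
  exists t; rewrite set_nth_cat ?szR' // set_nthK //.
  by rewrite -cats1 -catA.
- have [|||T cardT reachT] := IH R' subR'.
  + apply: levels_nonemptyS R0; split=> // j.
    by rewrite nth_set_nth /=; case: eqP => [->|//]; rewrite subsetUr.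
  + by rewrite blS blR'; lia.
  + by lia.
  have incT : ~~ complete T.
    by apply/eqP => TF; move: cardT; rewrite TF cardsT card_ord; lia.
  have /subsetPn[t _ tT] : ~~ (F \subset T) by rewrite subTset.
  exists (t |: T); first by rewrite cardsU1 tT cardT.
  apply: (JL_move reachT); last by rewrite nonempty_round ?cardsU1 ?tT.
  (* Level [i] lies below the full level, so the ban on the level under an incomplete top is
     respected. *)
  exists i, s; rewrite size_cat szR' /= addn2.
  rewrite last_cat /= nth_cat szR' ltiR R'i setU11 (negbTE incT); split=> //.
  + by lia.
  exists t => //; rewrite set_nth_cat ?szR' // set_nthK //=.
  by rewrite set_nth_top.
Qed.

(* Backwards induction: the blocks of the last level of D can be put back into
   the lower levels, since these have n (k - 2) slots at least. *)
Lemma jenga_full_top J D : 2 <= k -> size D = k - 2 + J -> levels_nonempty D ->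
  blocks D = n * (k - 2) -> jenga_like n k (D ++ [:: F; F]).
Proof.
move=> k_ge2; elim: J D => [|J IH] D szD D0 blD.
  have -> : D = nseq (k - 2) F.
    apply: sublevels_blocks_eq; last by rewrite blocks_nseq cardsT card_ord blD mulnC.
    by have := sublevels_full D; rewrite szD addn0.
  suff <- : nseq k F = nseq (k - 2) F ++ [:: F; F] by exact: JL_init.
  by rewrite -{1}(subnK k_ge2) nseqD.
case/lastP: D szD D0 blD => [|D L]; first by rewrite addnS.
rewrite size_rcons addnS => -[szD].
rewrite /levels_nonempty all_rcons => /andP[L0 D0].
rewrite -cats1 blocks_cat => blD.
have [|S subDS blS] := @fill_levels D (blocks [:: L]).
  by rewrite blD szD mulnC leq_mul2r leq_addr orbT.
have reachS : jenga_like n k ((S ++ [:: F]) ++ [:: F]).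
  rewrite -catA; apply: IH; rewrite ?blS //; first by rewrite -(proj1 subDS).
  exact: levels_nonemptyS D0.
have n_gt0 : 0 < n by have /set0Pn[[x ltxn] _] := L0; apply: leq_ltn_trans ltxn.
(* The round takes [#|L|] blocks from [S] and [n - #|L|] from the full level above it, exactly
   enough to complete a new top. *)
have [||||T cardT reachT] := @jenga_round _ (D ++ [:: L]) n.-1 reachS.
- split=> [|j]; first by rewrite !size_cat (proj1 subDS).
  rewrite !nth_cat (proj1 subDS); case: ltnP => _; first exact: (proj2 subDS).
  by case: (j - size S) => [|[|?]] //=; exact: subsetT.
- by rewrite /levels_nonempty all_cat /= D0 L0.
- rewrite !blocks_cat blS; congr (_ + _).
  by rewrite /blocks big_seq1 cardsT card_ord prednK.
- by rewrite prednK.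
suff TF : T = F by rewrite TF in reachT.
by apply/eqP; rewrite eqEcard subsetT cardsT card_ord cardT prednK /=.
Qed.

(** One more round thins the lower of the two full levels to [A]. The shape of [T] is left open,
    since by [genus_runs] it does not affect the genus. *)
Lemma jenga_partial_top J D (A : {set 'I_n}) : 2 <= k -> size D = k - 2 + J ->
    levels_nonempty D -> blocks D = n * (k - 2) -> 0 < #|A| < n ->
  exists T : {set 'I_n}, jenga_like n k (D ++ [:: A; F; T]).
Proof.
move=> k_ge2 szD D0 blD /andP[A_gt0 A_lt].
have reachD := jenga_full_top k_ge2 szD D0 blD.
have [|||||T _ reachT] := @jenga_round (D ++ [:: F]) (D ++ [:: A]) (n - #|A|).-1.
- by rewrite -catA.
- split=> [|j]; first by rewrite !size_cat.
  rewrite !nth_cat; case: ltnP => // _.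
  by case: (j - size D) => [|[|?]] //=; exact: subsetT.
- by rewrite /levels_nonempty all_cat [all _ D]D0 /= -card_gt0 A_gt0.
- rewrite !blocks_cat /blocks !big_seq1 cardsT card_ord; lia.
- by lia.
by exists T; rewrite -catA in reachT.
Qed.

(** The sum omits level [m.-1] too: its term in the genus has the factor [runs F - 1 = 0], and its
    blocks could break the bound while the top is incomplete. *)
Definition jenga_invariant Q : Prop :=
  exists m, [/\ size Q = m.+2, nth set0 Q m = F, blocks Q = n * k
              & \sum_(i < m.-1) #|nth set0 Q i| <= n * (k - 2)].

Lemma jenga_invariantP Q : 2 <= k -> jenga_like n k Q -> jenga_invariant Q.
Proof.
move=> k_ge2; elim=> [|{}Q Q' _ [m [szQ Qm blQ preQ]] [i [s [ltiQ incQ sQ eqQ']]] _].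
  exists (k - 2); rewrite size_nseq blocks_nseq cardsT card_ord nth_nseq mulnC.
  split=> //; first by lia.
    by rewrite ifT //; lia.
  under eq_bigr => i _ do rewrite nth_nseq.
  apply: (@leq_trans (\sum_(i < (k - 2).-1) n)).
    by apply: leq_sum => i _; case: ifP => _; rewrite ?cardsT ?cards0 ?card_ord.
  by rewrite big_const_ord iter_addn_0 leq_mul2l leq_pred orbT.
rewrite szQ /= in ltiQ incQ eqQ'.
set Q1 := set_nth _ _ _ _ in eqQ'.
have szQ1 : size Q1 = m.+2 by rewrite size_set_nth szQ; apply/maxn_idPr; lia.
have blQ1 : (blocks Q1).+1 = n * k by rewrite blocks_del_slot.
have subQ1 j : #|nth set0 Q1 j| <= #|nth set0 Q j|.
  apply: subset_leq_card; rewrite nth_set_nth /=; case: eqP => [->|//].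
  exact: subD1set.
have Q1top : nth set0 Q1 m.+1 = nth set0 Q m.+1.
  by rewrite nth_set_nth /= gtn_eqF //; lia.
have lastQ : last set0 Q = nth set0 Q m.+1 by rewrite (last_nth set0) szQ.
case: ifP eqQ' incQ => [/eqP topF [t ->] _ | topF [t tT ->] /(_ isT) lti].
  exists m.+1; rewrite size_rcons szQ1; split=> //.
  - by rewrite nth_rcons szQ1 ltnS leqnn Q1top -lastQ.
  - by rewrite -cats1 blocks_cat /blocks big_seq1 cards1 addn1.
  (* Levels [m] and [m.+1] of [Q] are both full, which leaves [n * k - 2 * n] blocks below them. *)
  apply: (@leq_trans (\sum_(j < m) #|nth set0 Q j|)).
    by apply: leq_sum => j _; rewrite nth_rcons szQ1 ifT ?subQ1 //; have := ltn_ord j; lia.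
  move: blQ; rewrite blocks_nth szQ !big_ord_recr /= Qm -lastQ topF cardsT card_ord.
  by rewrite mulnBr; lia.
have tQ1 : t \notin nth set0 Q1 m.+1 by rewrite Q1top -lastQ.
exists m; rewrite size_set_nth szQ1; split.
- by apply/maxn_idPr; lia.
- by rewrite nth_set_nth /= ltn_eqF // nth_set_nth /= gtn_eqF.
- by rewrite lastQ -Q1top blocks_add_slot // szQ1.
(* The block lands above the counted levels, which can only lose blocks. *)
apply: leq_trans preQ; apply: leq_sum => j _.
by rewrite nth_set_nth /= ltn_eqF ?subQ1 //; have := ltn_ord j; lia.
Qed.

End Reachability.

(** * The upper bound and a configuration attaining it *)

Lemma gnk_half n k : gnk n k = (n.+1)./2.-1 * (n * (k - 2)).
Proof.
rewrite /gnk; have := odd_double_half n; case: ifP => _; set m := n./2 => <- /=.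
  have -> : (1 + m.*2) * (1 + m.*2 - 1) * (k - 2) = m * ((1 + m.*2) * (k - 2)) * 2.
    by rewrite add1n subn1 /= -muln2; ring.
  by rewrite mulnK // add1n /= doubleK.
have -> : (0 + m.*2) * (0 + m.*2 - 2) * (k - 2) = m.-1 * ((0 + m.*2) * (k - 2)) * 2.
  by rewrite add0n -[2 in X in _ * X * _]/(1.*2) -doubleB subn1 -!muln2; ring.
by rewrite mulnK // add0n uphalf_double.
Qed.

Lemma genus_upper n k (Q : seq {set 'I_n}) : 0 < n -> 2 <= k ->
  jenga_like n k Q -> (genus Q <= Posz (gnk n k))%R.
Proof.
move=> n_gt0 k_ge2 /(jenga_invariantP k_ge2)[m [szQ Qm _ preQ]].
rewrite (genus_runs n_gt0 szQ Qm); case: m szQ Qm preQ => [|m] szQ Qm /= preQ.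
  by rewrite big_ord0.
(* The last term vanishes because the level above it is full; the rest involves just the levels
   counted by the invariant. *)
rewrite big_ord_recr /= Qm runsT // subrr mulr0 addr0 gnk_half.
apply: (@le_trans _ _ (((n.+1)./2.-1 * \sum_(i < m) #|nth set0 Q i|)%N%:Z)%R); last first.
  by rewrite lez_nat leq_mul2l preQ orbT.
rewrite big_distrr /= (big_morph Posz PoszD (erefl (Posz 0))).
apply: ler_sum => i _; rewrite -[uphalf n]/((n.+1)./2).
set a := nth set0 Q i; set b := nth set0 Q i.+1.
have := runs_le_card a; have := runs_le_half b.
have : 0 < n.+1./2 by lia.
move: (n.+1./2) (runs a) (runs b) #|a| => h x y c h_gt0 leyh lexc.
apply: (@le_trans _ _ (Posz x * Posz h.-1)%R); first by rewrite ler_wpM2l //; lia.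
by rewrite -PoszM lez_nat mulnC leq_mul2l lexc orbT.
Qed.

(* b blocks pairwise separated by gaps, starting at the first slot *)
Definition comb n b : {set 'I_n} := [set j : 'I_n | ~~ odd j && (j./2 < b)].

Lemma in_level_comb n b j : in_level (comb n b) j = [&& j < n, ~~ odd j & j./2 < b].
Proof.
case: ltnP => [ltjn|lenj]; last by rewrite in_level_ge.
by rewrite (in_level_ord _ (Ordinal ltjn)) inE.
Qed.

Lemma card_comb n b : b <= (n.+1)./2 -> #|comb n b| = b.
Proof.
move=> leb; rewrite -sum_in_level.
have -> : \sum_(j < n) in_level (comb n b) j = \sum_(j < n) (~~ odd j && (j./2 < b)).
  by apply: eq_bigr => j _; rewrite in_level_comb ltn_ord.
(* As a minimum, the count needs no bound on [b] and can be proved by induction on [n]. *)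
rewrite -[RHS](minn_idPl leb) {leb}.
elim: n => [|n IH]; first by rewrite big_ord0 minn0.
by rewrite big_ord_recr /= IH; case: (boolP (odd n)) => /=; lia.
Qed.

(** The slot after an occupied one is odd, hence empty, so every block is a run of its own. *)
Lemma runs_comb n b : b <= (n.+1)./2 -> runs (comb n b) = b.
Proof.
move=> leb; rewrite -[RHS](card_comb leb) -sum_in_level.
apply: eq_bigr => j _; rewrite !in_level_comb /=.
by case: (odd j); rewrite /= ?andbF ?andbT.
Qed.

Lemma genus_full_tower n k : 0 < n -> 2 <= k -> genus (nseq k [set: 'I_n]) = 0%R.
Proof.
move=> n_gt0 k_ge2; rewrite (@genus_runs _ _ (k - 2)) ?size_nseq ?nth_nseq //; last first.
- by rewrite ifT //; lia.
- by lia.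
apply: big1 => i _; rewrite !nth_nseq ifT; last by have := ltn_ord i; lia.
by rewrite ifT ?runsT ?subrr ?mulr0 //; have := ltn_ord i; lia.
Qed.

Lemma genus_attained n k : 2 < n -> 2 < k ->
  exists Q : seq {set 'I_n}, jenga_like n k Q /\ genus Q = Posz (gnk n k).
Proof.
move=> n_gt2 k_gt2.
(* Division of [n * (k - 2)] by [h] with remainder [b] in 1..h instead of 0..h-1, so that the lowest
   level is not empty. *)
pose h := (n.+1)./2; pose t := (n * (k - 2)).-1; pose q := t %/ h; pose b := (t %% h).+1.
have h_gt0 : 0 < h by rewrite /h; lia.
have h_lt : h < n by rewrite /h; lia.
have leb : b <= h by rewrite /b ltn_mod.
have tE : b + q * h = n * (k - 2).
  rewrite /b addSn addnC -divn_eq /t prednK // muln_gt0; apply/andP; split; lia.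
have [||||T reachQ] := @jenga_partial_top n k (q.+1 - (k - 2))
    (comb n b :: nseq q (comb n h)) (comb n h) (ltnW k_gt2).
- rewrite /= size_nseq subnKC //.
  (* Each of the [q.+1] levels holds at most [h < n] blocks, so there are at least [k - 2] of
     them. *)
  have : n * (k - 2) <= n * q.+1.
    rewrite -tE; apply: (@leq_trans (h + q * h)); first by rewrite leq_add2r.
    by rewrite -mulSn mulnC leq_mul2r (ltnW h_lt) orbT.
  by rewrite leq_mul2l => /orP[/eqP n0|//]; rewrite n0 in n_gt2.
- rewrite /levels_nonempty /= all_nseq -!card_gt0 !card_comb //= h_gt0 orbT //.
- by rewrite -cat1s blocks_cat blocks_nseq /blocks big_seq1 !card_comb.
- by rewrite card_comb // h_gt0.
exists (comb n b :: (nseq q.+1 (comb n h) ++ [:: setT; T])); split.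
  by move: reachQ; rewrite -(addn1 q) nseqD /= -catA.
rewrite (@genus_runs _ _ q.+2); first last.
- by rewrite /= nth_cat size_nseq /= ltnn subnn.
- by rewrite /= size_cat size_nseq /= addn2.
- by lia.
(* The thinned level itself contributes 0, but it gives the level below it the full factor [h - 1].
   The total is [(b + q * h) * (h - 1)]. *)
rewrite big_ord_recr /= nth_cat size_nseq /= ltnn subnn /= runsT ?subrr ?mulr0 ?addr0; last by lia.
have nthE i : i <= q ->
    nth set0 (comb n h :: nseq q (comb n h) ++ [:: setT; T]) i = comb n h.
  move=> leiq; rewrite -cat_cons -[comb n h :: _]/(nseq q.+1 _) nth_cat size_nseq.
  by rewrite ltnS leiq nth_nseq ltnS leiq.
under eq_bigr => i _ do rewrite nthE -1?ltnS // runs_comb //.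
rewrite big_ord_recl /= runs_comb // gnk_half -tE.
under eq_bigr => i _ do rewrite nthE ?(ltnW (ltn_ord i)) // runs_comb //.
rewrite sumr_const card_ord -/h -mulr_natr.
nia.
Qed.

Theorem mainTheorem1 (n k : nat) (hn : (2 <= n)%N) (hk : (2 <= k)%N) :
  (forall Q : seq {set 'I_n}, jenga_like n k Q -> (genus Q <= Posz (gnk n k))%R) /\
  (exists Q : seq {set 'I_n}, jenga_like n k Q /\ genus Q = Posz (gnk n k)).
Proof.
have n_gt0 : 0 < n by apply: leq_trans hn.
split=> [Q|]; first exact: genus_upper.
have [/andP[n_gt2 k_gt2]|small] := boolP ((2 < n) && (2 < k)); first exact: genus_attained.
(* For [n = 2] or [k = 2] the bound is 0, the genus of the initial tower. *)
exists (nseq k setT); split; first exact: JL_init.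
rewrite genus_full_tower // gnk_half.
suff -> : (n.+1)./2.-1 * (n * (k - 2)) = 0 by [].
by move: small; rewrite negb_and -!leqNgt => /orP[n_le2|k_le2];
  [have -> : n = 2 by lia | have -> : k = 2 by lia]; rewrite ?muln0.
Qed.
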